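(* A simple connected graph $G$ satisfies $\dim_{ms}(G)=1$ if and only if it is a path graph.
   Context: Graphs are simple and connected; $d_G(u,v)$ is the length of a shortest $u$–$v$ path in $G$. For $S=\{w_1,\ldots,w_t\}\subseteq V(G)$ and $u\in V(G)$, the multiset representation of $u$ with respect to $S$ is the multiset $\operatorname{m}(u|S)$ consisting of $d_G(u,w_1),\ldots,d_G(u,w_t)$, counted with multiplicity. A set $S\subseteq V(G)$ is an outer multiset resolving set if $\operatorname{m}(u|S)\ne \operatorname{m}(v|S)$ for every two distinct $u,v\in V(G)\setminus S$; the outer multiset dimension $\dim_{ms}(G)$ is the minimum cardinality of such a set.
   Formalization: ''Path graph'' is taken to mean a path graph with at least two vertices, because the one-vertex path has the empty set as an outer multiset resolving set and so has dimension 0, not 1. *)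

(* Defs.v *)
From HB Require Import structures.
From mathcomp Require Import all_boot.
From mathcomp Require Import finmap multiset.

Set Implicit Arguments.
Unset Strict Implicit.
Unset Printing Implicit Defensive.

(* A finite simple graph is a finType T of vertices with a symmetric and      *)
(* irreflexive adjacency relation e : rel T.                                  *)

Section Graph.

Variables (T : finType) (e : rel T).

Definition connected_graph : Prop :=
  0 < #|T| /\ forall x y : T, connect e x y.

Definition has_path_of_length (x y : T) (n : nat) : bool :=
  [exists p : n.-tuple T,
    [&& path e x p, last x p == y & uniq (x :: p)]].

(* A path has distinct vertices, hence length < #|T|, so this is the least    *)
(* length of an x-y path (and #|T| when there is none); see distP.            *)
Definition dist (x y : T) : nat :=
  find (has_path_of_length x y) (iota 0 #|T|).

Definition mset_repr (u : T) (S : {set T}) : {mset nat}%mset :=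
  seq_mset [seq dist u w | w <- enum S].

Definition outer_ms_resolving (S : {set T}) : bool :=
  [forall u, forall v,
    [&& u \notin S, v \notin S & u != v] ==>
      (mset_repr u S != mset_repr v S)].

(* The base point [set: T] of the minimization is vacuously resolving.        *)
(* The empty set is allowed, so the one-vertex path has dimension 0.         *)
Definition dim_ms : nat :=
  #|[arg min_(S < [set: T] | outer_ms_resolving S) #|S|]|.

Definition is_path_graph : Prop :=
  exists n (f : 'I_n -> T),
    [/\ 0 < n, bijective f &
        forall i j : 'I_n, e (f i) (f j) = (i.+1 == j) || (j.+1 == i)].

Lemma has_path_of_lengthP x y n :
  reflect (exists p : seq T,
             [/\ path e x p, last x p = y, uniq (x :: p) & size p = n])
          (has_path_of_length x y n).
Proof.
apply: (iffP existsP) => [[p /and3P[pp /eqP lp up]]|[p [pp lp up sp]]].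
  by exists p; split; rewrite ?size_tuple.
have sp' : size p == n by rewrite sp.
by exists (Tuple sp'); rewrite /= pp lp eqxx.
Qed.

Lemma has_path_of_length_lt x y n : has_path_of_length x y n -> n < #|T|.
Proof.
case/has_path_of_lengthP=> p [_ _ up <-].
by rewrite -[(size p).+1]/(size (x :: p)) -(card_uniqP up) max_card.
Qed.

Lemma distP x y : connect e x y ->
  has_path_of_length x y (dist x y)
  /\ forall n, has_path_of_length x y n -> dist x y <= n.
Proof.
move=> /connectP[p pp ->]; case: (shortenP pp) => q qp uq _.
have hq : has_path_of_length x (last x q) (size q).
  by apply/has_path_of_lengthP; exists q.
have hasP' : has (has_path_of_length x (last x q)) (iota 0 #|T|).
  apply/hasP; exists (size q) => //.
  by rewrite mem_iota (has_path_of_length_lt hq).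
split.
  have := nth_find 0 hasP'; rewrite nth_iota //.
  by move: hasP'; rewrite has_find size_iota.
move=> n hn; rewrite leqNgt; apply/negP => lt_n.
have := before_find 0 lt_n.
by rewrite nth_iota ?add0n ?hn // (has_path_of_length_lt hn).
Qed.

Lemma outer_ms_resolvingP (S : {set T}) :
  reflect (forall u v, u \notin S -> v \notin S -> u <> v ->
             mset_repr u S <> mset_repr v S)
          (outer_ms_resolving S).
Proof.
apply: (iffP forallP) => [H u v uS vS /eqP uv|H u].
  by apply/eqP; move/forallP: (H u) => /(_ v)/implyP; apply; rewrite uS vS.
apply/forallP=> v; apply/implyP=> /and3P[uS vS /eqP uv].
by apply/eqP; apply: H.
Qed.

Lemma dim_msP :
  (exists2 S, outer_ms_resolving S & #|S| = dim_ms)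
  /\ forall S, outer_ms_resolving S -> dim_ms <= #|S|.
Proof.
rewrite /dim_ms; case: arg_minnP => [|S rS minS].
  by apply/outer_ms_resolvingP => u v; rewrite inE.
by split; [exists S|].
Qed.

End Graph.

(* Main.v *)
Require Import Defs.
From mathcomp Require Import all_boot.
From mathcomp Require Import finmap multiset.

(** A singleton [[set w]] is outer multiset resolving exactly when the distance
    to [w] is injective. In a connected graph it is then a bijection onto
    [{0, ..., #|T| - 1}]; adjacent vertices have distances to [w] differing by
    exactly one, and the unique vertex at distance [n.+1] has a neighbour at
    distance [n], so the distance to [w] identifies the graph with a path. *)

Section Distance.

Variables (T : finType) (e : rel T).
Hypothesis e_connect : forall x y : T, connect e x y.

(** [dist] minimizes over duplicate-free paths only; an arbitrary walk is first shortened to a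
    duplicate-free one whose vertices all lie on it. *)
Lemma dist_le_size (x : T) (p : seq T) :
  path e x p -> dist e x (last x p) <= size p.
Proof.
move=> ep; have [_ dist_min] := distP (e_connect x (last x p)).
case: (shortenP ep) dist_min => q eq uq sub_qp dist_min.
apply: (@leq_trans (size q)).
  by apply: dist_min; apply/has_path_of_lengthP; exists q.
by case/andP: uq => _ uq; apply: uniq_leq_size uq sub_qp.
Qed.

Lemma geodesic (x y : T) :
  exists p, [/\ path e x p, last x p = y & size p = dist e x y].
Proof.
have [/has_path_of_lengthP[p [ep lp _ sp]] _] := distP (e_connect x y).
by exists p.
Qed.

Lemma dist_lt_card (x y : T) : dist e x y < #|T|.
Proof.
by have [/has_path_of_length_lt] := distP (e_connect x y).
Qed.

Lemma dist_eq0 (x y : T) : (dist e x y == 0) = (x == y).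
Proof.
apply/eqP/eqP => [d0|->]; last first.
  by apply/eqP; rewrite -leqn0; apply: (@dist_le_size y [::]).
have [p [_ lp]] := geodesic x y; rewrite d0 => /size0nil p0.
by rewrite -lp p0.
Qed.

Lemma dist_edge (x y w : T) : e x y -> dist e x w <= (dist e y w).+1.
Proof.
move=> exy; have [p [ep <- <-]] := geodesic y w.
by apply: (@dist_le_size x (y :: p)); rewrite /= exy.
Qed.

(** Take [y] next after [x] on a geodesic: the rest of the geodesic bounds its distance above, the
    edge bounds it below. *)
Lemma dist_pred (x w : T) (n : nat) :
  dist e x w = n.+1 -> exists2 y, e x y & dist e y w = n.
Proof.
move=> dx; have [[|y p] [//= + lp sp]] := geodesic x w.
  by rewrite dx in sp.
case/andP=> exy ep; exists y => //; apply/eqP; rewrite eqn_leq.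
have := dist_edge _ _ w exy; rewrite dx ltnS => ->; rewrite andbT.
by move: sp; rewrite dx -lp => -[<-]; apply: dist_le_size.
Qed.

(** Representations are one-element multisets. Resolving says nothing about [w] itself, but [w] is
    the only vertex at distance 0. *)
Lemma outer_ms_resolving1P (w : T) :
  reflect (injective (fun u => dist e u w)) (outer_ms_resolving e [set w]).
Proof.
have repr_eq u v :
    mset_repr e u [set w] = mset_repr e v [set w] <-> dist e u w = dist e v w.
  rewrite /mset_repr enum_set1 /=; split=> [|-> //].
  by move/eq_seq_msetP/perm_small_eq => /(_ isT)[].
apply: (iffP (outer_ms_resolvingP e _)) => [res u v duv|inj u v _ _ uv].
  have eqw x y : dist e x w = dist e y w -> x = w -> y = w.
    by move=> dxy /eqP; rewrite -dist_eq0 dxy dist_eq0 => /eqP.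
  have [uw|uw] := eqVneq u w; first by rewrite (eqw _ _ duv uw).
  have [vw|vw] := eqVneq v w; first by rewrite (eqw _ _ (esym duv) vw) vw.
  have [// | /eqP uv] := eqVneq u v.
  by case: (res u v); rewrite ?in_set1 //; apply/repr_eq.
by move/repr_eq/inj.
Qed.

End Distance.

(** Every vertex is represented by the empty multiset. *)
Lemma outer_ms_resolving0 (T : finType) (e : rel T) :
  outer_ms_resolving e set0 = (#|T| <= 1).
Proof.
apply/(outer_ms_resolvingP e _)/idP => [res|/fintype_le1P eqT u v _ _].
  apply/fintype_le1P => u v; have [// | /eqP vu] := eqVneq v u.
  by case: (res v u); rewrite ?in_set0 // /mset_repr enum_set0.
by rewrite (eqT u v).
Qed.

Lemma dim_ms_eq1 (T : finType) (e : rel T) :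
  dim_ms e = 1 <->
  1 < #|T| /\ exists w : T, outer_ms_resolving e [set w].
Proof.
have [[S resS cardS] dim_min] := dim_msP e; split=> [d1|[T_gt1 [w resw]]].
  split; last by move/eqP: cardS; rewrite d1 => /cards1P[w Sw]; exists w; rewrite -Sw.
  rewrite ltnNge -(outer_ms_resolving0 _ e).
  by apply/negP=> /dim_min; rewrite d1 cards0.
apply/eqP; rewrite eqn_leq -{1}(cards1 w) dim_min //= -cardS card_gt0.
by apply: contraTneq resS => ->; rewrite outer_ms_resolving0 -ltnNge.
Qed.

Lemma path_graph_of_dist_inj (T : finType) (e : rel T) (w : T) :
  symmetric e -> irreflexive e -> (forall x y, connect e x y) ->
  injective (fun u => dist e u w) -> is_path_graph e.
Proof.
move=> e_sym e_irrefl e_connect inj.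
pose g u := Ordinal (dist_lt_card _ _ e_connect u w).
have g_inj : injective g by move=> u v [/inj].
(* Domain and codomain both have [#|T|] elements; the inverse [f] lists the vertices by distance to
   [w]. *)
have [f gK fK] : bijective g by apply: inj_card_bij g_inj _; rewrite card_ord.
have distf i : dist e (f i) w = i by rewrite -[RHS](congr1 val (fK i)).
exists #|T|, f; split; first by apply/card_gt0P; exists w.
  by exists g.
have adj_succ (i j : 'I_#|T|) : i.+1 = j -> e (f i) (f j).
  rewrite -(distf j) => /esym/(dist_pred _ _ e_connect)[v ev dv].
  by rewrite e_sym; rewrite -(distf i) in dv; rewrite -(inj _ _ dv).
move=> i j; apply/idP/orP => [eij|[]/eqP/adj_succ //]; last by rewrite e_sym.
(* Using the edge in both directions, [i] and [j] differ by at most one. *)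
have := dist_edge _ _ e_connect _ _ w eij; rewrite e_sym in eij.
have := dist_edge _ _ e_connect _ _ w eij; rewrite !distf => le_ji le_ij.
have [lt_ij|lt_ji|/val_inj eq_ij] := ltngtP i j.
- by left; rewrite eqn_leq lt_ij.
- by right; rewrite eqn_leq lt_ji.
- by rewrite eq_ij e_irrefl in eij.
Qed.

(** With [w] the initial end of the path, the distance to [w] is the index along the path. *)
Lemma path_graph_dist_inj (T : finType) (e : rel T) :
  (forall x y, connect e x y) -> is_path_graph e ->
  exists w, injective (fun u => dist e u w).
Proof.
move=> e_connect [n [f [n_gt0 [g gK fK] adj]]].
have f_inj := can_inj gK.
pose w := f (Ordinal n_gt0); exists w.
(* An edge changes the index by one, so a geodesic to index 0 needs at least [i] edges. *)
have dist_ge k (i : 'I_n) : dist e (f i) w = k -> i <= k.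
  elim: k i => [|k IHk] i.
    by move/eqP; rewrite dist_eq0 // => /eqP/f_inj ->.
  case/(dist_pred _ _ e_connect) => v; rewrite -(fK v) adj => ev /IHk le_k.
  case/orP: ev => /eqP eq_i; last by rewrite -eq_i.
  by apply: ltnW; rewrite ltnS -ltnS eq_i ltnW.
have dist_le k (lt_k : k < n) : dist e (f (Ordinal lt_k)) w <= k.
  elim: k lt_k => [|k IHk] lt_k.
    by rewrite leqn0 dist_eq0 //; apply/eqP; congr f; apply: val_inj.
  have := IHk (ltnW lt_k); rewrite -ltnS; apply: leq_trans.
  by apply: dist_edge => //; rewrite adj /= eqxx orbT.
have distf (i : 'I_n) : dist e (f i) w = i.
  by apply/eqP; rewrite eqn_leq (dist_ge _ _ erefl) andbT; case: i.
move=> u v; rewrite -(fK u) -(fK v) !distf => eq_uv.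
by congr f; apply: val_inj.
Qed.

(** The bound [1 < #|T|] excludes the one-vertex path, which the empty set resolves. *)
Theorem mainTheorem5 (T : finType) (e : rel T)
    (e_sym : symmetric e) (e_irrefl : irreflexive e)
    (e_conn : connected_graph e) :
  dim_ms e = 1 <-> is_path_graph e /\ 1 < #|T|.
Proof.
have [_ e_connect] := e_conn; split.
  case/dim_ms_eq1=> T_gt1 [w /(outer_ms_resolving1P _ _ e_connect) inj].
  by split=> //; apply: path_graph_of_dist_inj inj.
case=> /(path_graph_dist_inj _ _ e_connect)[w inj] T_gt1.
by apply/dim_ms_eq1; split=> //; exists w; apply/outer_ms_resolving1P.
Qed.
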